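(* Fix a bandwidth-sharing network structure $(\mathbf A,\mathbf C,\boldsymbol\kappa)$ and $\alpha>0$, and consider the network under the $\alpha$-fair policy with traffic parameters $(\boldsymbol\mu,\boldsymbol\nu)$ such that $\mathbf A\boldsymbol\rho<\mathbf C$ componentwise. Let $\varepsilon=\varepsilon(\boldsymbol\rho)$ be the gap and $(\tilde{\mathbf N}(\tau))_{\tau\in\mathbb Z_+}$ the uniformized Markov chain. Then there exist a positive constant $B$ and a positive load-dependent constant $K$ such that, whenever $L_\alpha(\tilde{\mathbf N}(\tau))>B$, $$\mathbb E\big[L_\alpha(\tilde{\mathbf N}(\tau+1))-L_\alpha(\tilde{\mathbf N}(\tau))\,\big|\,\tilde{\mathbf N}(\tau)\big]\le-\varepsilon K .$$ Furthermore, $B$ takes the form $K'/\varepsilon$ when $\alpha\ge1$, and $K'/\min\{\varepsilon^{1/\alpha},\varepsilon\}$ when $\alpha\in(0,1)$, with $K'$ a positive load-dependent constant.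
   Context: Network. $\mathcal J$ is a finite set of resources and $\mathcal I$ a finite set of routes, each route being identified with a nonempty subset of $\mathcal J$. $\mathbf A$ is the $|\mathcal J|\times|\mathcal I|$ matrix with $A_{ji}=1$ if route $i$ uses resource $j$ and $A_{ji}=0$ otherwise; it has rank $|\mathcal J|$. $\mathbf C=(C_j)_{j\in\mathcal J}$ has positive entries (capacities), $\boldsymbol\kappa=(\kappa_i)_{i\in\mathcal I}$ has positive entries (weights), $\alpha>0$. Traffic parameters: $\nu_i>0$ (arrival rates), $\mu_i>0$ (service rates), $\rho_i=\nu_i/\mu_i$. $\alpha$-fair policy. For $\mathbf n\in\mathbb R_+^{|\mathcal I|}$ let $\mathcal I_+(\mathbf n)=\{i:n_i>0\}$. Set $\Lambda_i(\mathbf n)=0$ for $i\notin\mathcal I_+(\mathbf n)$; if $\mathbf n\neq\mathbf 0$, $(\Lambda_i(\mathbf n))_{i\in\mathcal I_+(\mathbf n)}$ is the unique maximizer, over nonnegative vectors $(\Lambda_i)_{i\in\mathcal I_+(\mathbf n)}$ with $\sum_{i\in\mathcal I_+(\mathbf n)}A_{ji}\Lambda_i\le C_j$ for all $j\in\mathcal J$, of $\sum_{i\in\mathcal I_+(\mathbf n)}\kappa_i n_i^\alpha\frac{\Lambda_i^{1-\alpha}}{1-\alpha}$ if $\alpha\ne1$, and of $\sum_{i\in\mathcal I_+(\mathbf n)}\kappa_i n_i\log\Lambda_i$ if $\alpha=1$. Uniformized chain. The flow process is the continuous-time Markov process on $\mathbb Z_+^{|\mathcal I|}$ with rates $q(\mathbf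 n,\mathbf n+\mathbf e_i)=\nu_i$, $q(\mathbf n,\mathbf n-\mathbf e_i)=\mu_i\Lambda_i(\mathbf n)$ if $n_i\ge1$, and no other transitions. Let $\Xi=\sum_{i\in\mathcal I}(\nu_i+\mu_i\max_{j\in\mathcal J}C_j)$, which bounds the total transition rate out of every state. The uniformized chain $\tilde{\mathbf N}(\cdot)$ is the discrete-time Markov chain on $\mathbb Z_+^{|\mathcal I|}$ with transition probabilities $\tilde P(\mathbf n,\mathbf n\pm\mathbf e_i)=q(\mathbf n,\mathbf n\pm\mathbf e_i)/\Xi$ and remaining probability assigned to staying at $\mathbf n$. Lyapunov function. For $\alpha\ge1$, $h_\alpha(r)=r^\alpha$ for $r\ge0$. For $\alpha\in(0,1)$, $h_\alpha(r)=r^\alpha$ if $r\ge1$ and $h_\alpha(r)=(\alpha-1)r^3+(1-\alpha)r^2+r$ if $0\le r<1$. $H_\alpha(r)=\int_0^rh_\alpha(s)\,ds$, and for $\mathbf n\in\mathbb R_+^{|\mathcal I|}$, $$L_\alpha(\mathbf n)=\Big[(\alpha+1)\sum_{i\in\mathcal I}\kappa_i\mu_i^{\alpha-1}\nu_i^{-\alpha}H_\alpha(n_i)\Big]^{1/(\alpha+1)}.$$ Gap. If $\mathbf A\boldsymbol\rho<\mathbf C$ componentwise, $\varepsilon(\boldsymbol\rho)=\sup\{\tilde\varepsilon>0:(1+\tilde\varepsilon)\mathbf A\boldsymbol\rho\le\mathbf C\}$. Load-dependent constant. With $(\mathbf A,\mathbf C,\boldsymbol\kappa,\alpha)$ fixed,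 a positive load-dependent constant is a quantity of the form $K=f(\boldsymbol\mu,\boldsymbol\nu)$, where $f:(0,\infty)^{|\mathcal I|}\times(0,\infty)^{|\mathcal I|}\to(0,\infty)$ is a continuous function determined by $(\mathbf A,\mathbf C,\boldsymbol\kappa,\alpha)$ only. *)

(* Defs.v *)
From HB Require Import structures.
From mathcomp Require Import all_boot all_order all_algebra.
From mathcomp Require Import all_classical all_reals all_analysis.
Set Implicit Arguments.
Unset Strict Implicit.
Unset Printing Implicit Defensive.
Import Order.TTheory GRing.Theory Num.Theory.
Import numFieldNormedType.Exports.
Local Open Scope classical_set_scope.
Local Open Scope ring_scope.

(* Resources are 'I_J, routes are 'I_I; a vector over one of these index sets
   is a column vector, its i-th entry being [x i 0]. *)

Definition incidence (R : realType) (J I : nat) (route : 'I_I -> {set 'I_J}) :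
  'M[R]_(J, I) := \matrix_(j, i) (j \in route i)%:R.

Definition positive (R : realType) (n : nat) (x : 'cV[R]_n) : Prop :=
  forall i, 0 < x i 0.

(* Since [powR 0 (1 - alpha)] and [ln 0] are both 0 in the library for
   [alpha > 1] and [alpha = 1] respectively, the value -oo of the utility of a
   zero bandwidth when alpha >= 1 has to be given explicitly. *)
Definition utility (R : realType) (alpha x : R) : \bar R :=
  if (1 <= alpha) && (x == 0) then -oo%E
  else if alpha == 1 then (ln x)%:E
  else (x `^ (1 - alpha) / (1 - alpha))%:E.

(* For alpha = 1 the weight below is kappa_i * n_i. *)
Definition objective (R : realType) (I : nat) (kappa : 'cV[R]_I) (alpha : R)
    (n x : 'cV[R]_I) : \bar R :=
  (\sum_(i < I | (0 < n i ord0)%R)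
     (kappa i ord0 * n i ord0 `^ alpha)%R%:E * utility alpha (x i ord0))%E.

(* Only the entries of x indexed by {i | n_i > 0} matter. *)
Definition feasible (R : realType) (J I : nat) (A : 'M[R]_(J, I))
    (C : 'cV[R]_J) (n x : 'cV[R]_I) : Prop :=
  (forall i, 0 < n i 0 -> 0 <= x i 0) /\
  (forall j, \sum_(i < I | 0 < n i 0) A j i * x i 0 <= C j 0).

Definition alpha_fair (R : realType) (J I : nat) (A : 'M[R]_(J, I))
    (C : 'cV[R]_J) (kappa : 'cV[R]_I) (alpha : R)
    (Lambda : 'cV[R]_I -> 'cV[R]_I) : Prop :=
  forall n : 'cV[R]_I, (forall i, 0 <= n i 0) ->
    (forall i, ~~ (0 < n i 0) -> Lambda n i 0 = 0) /\
    (n != 0 ->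
       feasible A C n (Lambda n) /\
       forall x, feasible A C n x ->
         (objective kappa alpha n x <= objective kappa alpha n (Lambda n))%E).

Definition load (R : realType) (I : nat) (mu nu : 'cV[R]_I) : 'cV[R]_I :=
  \col_i (nu i 0 / mu i 0).

Definition gap (R : realType) (J I : nat) (A : 'M[R]_(J, I)) (C : 'cV[R]_J)
    (rho : 'cV[R]_I) : R :=
  sup [set e : R | 0 < e /\ forall j, (1 + e) * (A *m rho) j 0 <= C j 0].

Definition state (I : nat) := 'cV[nat]_I.

Definition unit_state (I : nat) (i : 'I_I) : state I := delta_mx i 0.

Definition real_state (R : realType) (I : nat) (s : state I) : 'cV[R]_I :=
  map_mx (fun k : nat => k%:R) s.
Arguments real_state R {I} s.

(* [s == s' + unit_state i] says that s' = s - e_i and s_i >= 1. *)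
Definition rate (R : realType) (I : nat) (mu nu : 'cV[R]_I)
    (Lambda : 'cV[R]_I -> 'cV[R]_I) (s s' : state I) : R :=
  \sum_(i < I | s' == s + unit_state i) nu i 0 +
  \sum_(i < I | s == s' + unit_state i) mu i 0 * Lambda (real_state R s) i 0.

Definition total_rate (R : realType) (I : nat) (mu nu : 'cV[R]_I)
    (Lambda : 'cV[R]_I -> 'cV[R]_I) (s : state I) : R :=
  \sum_(i < I) nu i 0 +
  \sum_(i < I | (0 < s i ord0)%N) mu i 0 * Lambda (real_state R s) i 0.

(* The capacities being positive, 0 is harmless as base value of the max. *)
Definition Xi (R : realType) (J I : nat) (C : 'cV[R]_J) (mu nu : 'cV[R]_I) : R :=
  \sum_(i < I) (nu i 0 + mu i 0 * \big[Num.max/0]_(j < J) C j 0).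

Definition uniformized (R : realType) (J I : nat) (C : 'cV[R]_J)
    (mu nu : 'cV[R]_I) (Lambda : 'cV[R]_I -> 'cV[R]_I) (s s' : state I) : R :=
  if s' == s then 1 - total_rate mu nu Lambda s / Xi C mu nu
  else rate mu nu Lambda s s' / Xi C mu nu.

(* Time-homogeneous Markov chain on a countable state space, with an arbitrary
   initial distribution: P(N_0 = x_0, ..., N_(t+1) = x_(t+1))
   = P(N_0 = x_0, ..., N_t = x_t) * p(x_t, x_(t+1)). *)
Definition markov_chain (d : measure_display) (T : measurableType d)
    (R : realType) (P : probability T R) (S : countType) (p : S -> S -> R)
    (N : nat -> T -> S) : Prop :=
  (forall t s, measurable (N t @^-1` [set s])) /\
  (forall (t : nat) (x : nat -> S),
     P (\bigcap_(k in `I_t.+2) N k @^-1` [set x k]) =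
     (P (\bigcap_(k in `I_t.+1) N k @^-1` [set x k]) * (p (x t) (x t.+1))%:E)%E).

(* E[X | E], for an event E of positive probability. *)
Definition cond_expectation (d : measure_display) (T : measurableType d)
    (R : realType) (P : probability T R) (X : T -> R) (E : set T) : \bar R :=
  (((fine (P E))^-1)%R%:E * \int[P]_(w in E) (X w)%:E)%E.

Definition h_alpha (R : realType) (alpha r : R) : R :=
  if (1 <= alpha) || (1 <= r) then r `^ alpha
  else (alpha - 1) * r ^+ 3 + (1 - alpha) * r ^+ 2 + r.

Definition H_alpha (R : realType) (alpha r : R) : R :=
  \int[@lebesgue_measure R]_(s in `[0, r]) h_alpha alpha s.

Definition lyapunov (R : realType) (I : nat) (kappa : 'cV[R]_I) (alpha : R)
    (mu nu n : 'cV[R]_I) : R :=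
  ((alpha + 1) *
   \sum_(i < I) kappa i 0 * mu i 0 `^ (alpha - 1) * nu i 0 `^ (- alpha) *
                H_alpha alpha (n i 0)) `^ (1 / (alpha + 1)).

Definition load_dependent (R : realType) (I : nat)
    (f : 'cV[R]_I * 'cV[R]_I -> R) : Prop :=
  let D := [set z : 'cV[R]_I * 'cV[R]_I | positive z.1 /\ positive z.2] in
  {within D, continuous f} /\ forall z, D z -> 0 < f z.

(* Main.v *)
Require Import Defs.
From HB Require Import structures.
From mathcomp Require Import all_boot all_order all_algebra.
From mathcomp Require Import all_classical all_reals all_analysis.
From mathcomp Require Import ring lra measurable_realfun.
Set Implicit Arguments.
Unset Strict Implicit.
Unset Printing Implicit Defensive.
Import Order.TTheory GRing.Theory Num.Theory.
Import numFieldNormedType.Exports.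
Local Open Scope classical_set_scope.
Local Open Scope ring_scope.

(* Let w_i = kappa_i mu_i^(alpha-1) nu_i^(-alpha) and F(n) = sum_i w_i H(n_i), so
   that L = ((alpha+1) F)^(1/(alpha+1)). Concavity of this power reduces the drift
   of L to L^(-alpha) times the drift of F. As h is nondecreasing and
   h(k) = k^alpha at every natural number k, the drift of F is at most the sum of
   - a first-order part sum_i w_i n_i^alpha (nu_i - mu_i Lambda_i); the tangent
     inequality for the concave utility at the feasible point (1+eps) rho bounds
     it by -eps S, where S = sum_i w_i nu_i n_i^alpha >= L^alpha / lyap_slope;
   - a second-order part of size lyap_noise * L^(max(alpha,1)-1).
   Beyond the threshold the second part is at most half of the first. *)

Lemma ln_le_sub1 (R : realType) (x : R) : 0 < x -> ln x <= x - 1.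
Proof. by move=> x0; have := @le_ln1Dx R (x - 1); rewrite subrKC; apply; lra. Qed.

Lemma powR_sub1_le (R : realType) (p t : R) :
  0 <= p <= 1 -> 0 <= t -> t `^ p - 1 <= p * (t - 1).
Proof.
move=> /andP[p0 p1]; rewrite le_eqVlt => /predU1P[<-|t0].
  by have [->|pn] := eqVneq p 0; rewrite ?powRr0 ?powR0//; lra.
pose z := 1 + p * (t - 1).
have z0 : 0 < z by rewrite /z; nra.
suff : t `^ p <= z by rewrite /z; lra.
rewrite -[leRHS]lnK// /powR gt_eqF// ler_expR -subr_le0.
have -> : p * ln t - ln z = p * ln (t / z) + (1 - p) * ln z^-1.
  by rewrite ln_div ?posrE// lnV ?posrE//; ring.
have h1 := ln_le_sub1 (divr_gt0 t0 z0).
have zi : 0 < z^-1 by rewrite invr_gt0.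
have h2 := ln_le_sub1 zi.
apply: (@le_trans _ _ (p * (t / z - 1) + (1 - p) * (z^-1 - 1))).
  by apply: lerD; apply: ler_wpM2l => //; lra.
rewrite le_eqVlt; apply/orP; left; apply/eqP.
transitivity (z / z - 1); last by rewrite divff ?gt_eqF// subrr.
by rewrite /z; ring.
Qed.

Lemma powR_sub1_ge (R : realType) (p t : R) :
  1 <= p -> 0 <= t -> p * (t - 1) <= t `^ p - 1.
Proof.
move=> p1 t0; have p0 : 0 < p by lra.
have := @powR_sub1_le R p^-1 (t `^ p).
rewrite -powRrM divff ?gt_eqF// powRr1// invr_ge0 (ltW p0) invf_le1// p1.
by move=> /(_ isT (powR_ge0 _ _)); rewrite mulrC ler_pdivlMr// mulrC.
Qed.

Lemma powR_sub1_ge_neg (R : realType) (p t : R) :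
  p <= 0 -> 0 < t -> p * (t - 1) <= t `^ p - 1.
Proof.
move=> p0 t0; rewrite /powR gt_eqF//.
have h1 := expR_ge1Dx (p * ln t); have h2 := ln_le_sub1 t0.
have : p * (t - 1) <= p * ln t by apply: ler_wnM2l.
lra.
Qed.

Lemma powR_sub_rescale (R : realType) (p a b : R) : 0 < a -> 0 <= b ->
  (b `^ p - a `^ p = a `^ p * ((b / a) `^ p - 1)) *
  (p * a `^ (p - 1) * (b - a) = a `^ p * (p * (b / a - 1))).
Proof.
move=> a0 b0; have an : a != 0 by rewrite gt_eqF.
split; last by rewrite powRB ?an ?implybT// powRr1 ?ltW//; field.
rewrite powRM// ?invr_ge0 ?ltW// -[a^-1]powR_inv1 ?ltW// -powRrM mulN1r powRN.
by field; rewrite powR_eq0 (negbTE an).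
Qed.

Lemma powR_concave_tangent (R : realType) (p a b : R) :
  0 <= p <= 1 -> 0 < a -> 0 <= b ->
  b `^ p - a `^ p <= p * a `^ (p - 1) * (b - a).
Proof.
move=> p01 a0 b0; rewrite !powR_sub_rescale// ler_pM2l ?powR_gt0//.
by apply: powR_sub1_le => //; rewrite divr_ge0// ltW.
Qed.

Lemma powR_convex_tangent (R : realType) (p a b : R) :
  1 <= p -> 0 < a -> 0 <= b ->
  p * a `^ (p - 1) * (b - a) <= b `^ p - a `^ p.
Proof.
move=> p01 a0 b0; rewrite !powR_sub_rescale// ler_pM2l ?powR_gt0//.
by apply: powR_sub1_ge => //; rewrite divr_ge0// ltW.
Qed.

Lemma powR_convex_tangent_neg (R : realType) (p a b : R) :
  p <= 0 -> 0 < a -> 0 < b ->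
  p * a `^ (p - 1) * (b - a) <= b `^ p - a `^ p.
Proof.
move=> p01 a0 b0; have b0' := ltW b0.
by rewrite !powR_sub_rescale// ler_pM2l ?powR_gt0// powR_sub1_ge_neg// divr_gt0.
Qed.

Lemma powR_increment_le (R : realType) (p x : R) : 0 < p -> 0 <= x ->
  (x + 1) `^ p - x `^ p <= Num.max p 1 * (x + 1) `^ (Num.max p 1 - 1).
Proof.
move=> p0 x0; have x1 : 0 < x + 1 by lra.
have [p1|p1] := leP 1 p.
  by have := powR_convex_tangent p1 x1 x0; lra.
rewrite subrr powRr0 mulr1.
have [->|xn] := eqVneq x 0.
  by rewrite add0r powR1 powR0 ?gt_eqF// subr0.
have xp : 0 < x by rewrite lt_neqAle eq_sym xn.
rewrite -(@ler_pM2r _ (x + 1))// mulrDl mulNr mul1r.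
have h : (x + 1) `^ p / (x + 1) <= x `^ p / x.
  have e (z : R) : 0 < z -> z `^ p / z = z `^ (- (1 - p)).
    by move=> z0; rewrite opprB powRB ?(gt_eqF z0) ?implybT// powRr1// ltW.
  rewrite !e//.
  rewrite !powRN lef_pV2 ?posrE ?powR_gt0// ge0_ler_powR ?nnegrE ?ltW//; lra.
have h1 : (x + 1) `^ p * x <= x `^ p * (x + 1).
  by move: h; rewrite ler_pdivrMr// mulrAC ler_pdivlMr.
have h2 : (x + 1) `^ p <= x + 1.
  by apply: ler1_powR; lra.
nra.
Qed.

Lemma utility_tangent (R : realType) (alpha x y : R) :
  0 < alpha -> 0 <= x -> 0 < y ->
  (utility alpha x <= utility alpha y + (y `^ (- alpha) * (x - y))%:E)%E /\
  utility alpha y \is a fin_num.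
Proof.
move=> a0 x0 y0; rewrite /utility (gt_eqF y0) andbF.
split; last by case: ifP.
have e : y `^ (1 - alpha - 1) = y `^ (- alpha) by congr (_ `^ _); ring.
have [/andP[_ _]|xn] := boolP ((1 <= alpha) && (x == 0)); first exact: leNye.
have [a1|an1] := eqVneq alpha 1.
  have xp : 0 < x by rewrite lt_neqAle x0 andbT eq_sym; move: xn; rewrite a1 lexx.
  rewrite -EFinD lee_fin a1 powR_inv1 ?(ltW y0)//.
  have := ln_le_sub1 (divr_gt0 xp y0); rewrite ln_div ?posrE//.
  have -> : x / y - 1 = y^-1 * (x - y) by field; rewrite gt_eqF.
  by rewrite lerBlDl.
rewrite -EFinD lee_fin -lerBlDl -mulrBl.
have [a1|a1] := ltP alpha 1.
  rewrite ler_pdivrMr ?subr_gt0// -e mulrC mulrA.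
  by apply: powR_concave_tangent => //; lra.
have a1' : alpha > 1 by rewrite lt_neqAle eq_sym an1.
rewrite ler_ndivrMr ?subr_lt0// -e mulrC mulrA.
have xp : 0 < x by rewrite lt_neqAle x0 andbT eq_sym; move: xn; rewrite a1.
by apply: powR_convex_tangent_neg => //; lra.
Qed.

Lemma h_alpha_natr (R : realType) (alpha : R) (n : nat) :
  0 < alpha -> h_alpha alpha n%:R = n%:R `^ alpha.
Proof.
move=> a0; rewrite /h_alpha; case: n => [|n]; last by rewrite ler1n orbT.
by case: ifP => // _; rewrite powR0 ?gt_eqF// !expr0n/= !mulr0 !add0r.
Qed.

Lemma h_alpha_le (R : realType) (alpha r s : R) :
  0 < alpha -> 0 <= r -> r <= s -> h_alpha alpha r <= h_alpha alpha s.
Proof.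
move=> a0 r0 rs; have s0 : 0 <= s by lra.
rewrite /h_alpha; have [a1/=|a1/=] := leP 1 alpha.
  by rewrite ge0_ler_powR ?nnegrE// (ltW a0).
have [r1|r1] := leP 1 r.
  by rewrite (le_trans r1 rs) ge0_ler_powR ?nnegrE// (ltW a0).
have key (x y : R) : 0 <= x -> x <= y -> y <= 1 ->
    (alpha - 1) * x ^+ 3 + (1 - alpha) * x ^+ 2 + x <=
    (alpha - 1) * y ^+ 3 + (1 - alpha) * y ^+ 2 + y.
  move=> x0 xy y1; rewrite -subr_ge0.
  have -> : (alpha - 1) * y ^+ 3 + (1 - alpha) * y ^+ 2 + y -
     ((alpha - 1) * x ^+ 3 + (1 - alpha) * x ^+ 2 + x) =
    (y - x) * (1 - (1 - alpha) * (y ^+ 2 + x * y + x ^+ 2 - x - y)) by ring.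
  apply: mulr_ge0; first by lra.
  have : y ^+ 2 + x * y + x ^+ 2 - x - y <= 1 by nra.
  nra.
have [s1|s1] := leP 1 s; last by apply: key => //; lra.
apply: (@le_trans _ _ 1).
  by apply: le_trans (key r 1 _ _ _) _ => //; [lra|rewrite !expr1n; lra].
by rewrite -[leLHS](powRr0 s) ler_powR// ltW.
Qed.

Lemma measurable_h_alpha (R : realType) (alpha : R) :
  measurable_fun [set: R] (h_alpha alpha).
Proof.
have mq : measurable_fun [set: R]
    (fun r : R => (alpha - 1) * r ^+ 3 + (1 - alpha) * r ^+ 2 + r).
  apply: measurable_funD => //; apply: measurable_funD;
    by apply: measurable_funM => //; exact: measurable_funX.
rewrite /h_alpha; have [a1|a1] := boolP (1 <= alpha) => /=.
  exact: measurable_powR.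
apply: measurable_fun_if => //=.
- exact: measurable_fun_ler.
- by apply: measurable_funTS; exact: measurable_powR.
- exact: measurable_funTS.
Qed.

Lemma integrable_h_alpha (R : realType) (alpha b : R) : 0 < alpha ->
  (@lebesgue_measure R).-integrable `[0, b] (EFin \o h_alpha alpha).
Proof.
move=> a0; apply: measurable_bounded_integrable => //=.
- by rewrite lebesgue_measure_itv/=; case: ifP => _; rewrite ltry.
- by apply: measurable_funTS; exact: measurable_h_alpha.
exists (h_alpha alpha b); split; first exact: num_real.
move=> M bM x /=; rewrite in_itv/= => /andP[x0 xb].
rewrite ger0_norm; first by apply: le_trans (h_alpha_le a0 x0 xb) (ltW bM).
have := @h_alpha_le R alpha 0 x a0 (lexx _) x0.
by rewrite -[X in h_alpha alpha X <= _]/(0%:R) h_alpha_natr// powR0// gt_eqF.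
Qed.

Lemma H_alpha0 (R : realType) (alpha : R) : H_alpha alpha 0 = 0.
Proof. by rewrite /H_alpha set_itv1 Rintegral_set1. Qed.

Lemma H_alpha_sub (R : realType) (alpha a b : R) : 0 < alpha ->
  0 <= a -> a <= b ->
  (b - a) * h_alpha alpha a <= H_alpha alpha b - H_alpha alpha a
    <= (b - a) * h_alpha alpha b.
Proof.
move=> al0 a0 ab; rewrite /H_alpha.
rewrite (@Rintegral_itvB R _ _ (BRight b)) ?bnd_simp//; last first.
  exact: integrable_h_alpha.
have ih : (@lebesgue_measure R).-integrable `]a, b] (EFin \o h_alpha alpha).
  apply: integrableS (integrable_h_alpha b al0) => //.
  by apply: subset_itvr; rewrite bnd_simp.
have ic (c : R) : (@lebesgue_measure R).-integrable `]a, b] (EFin \o cst c).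
  apply: measurable_bounded_integrable => //=; last exact: bounded_cst.
  by rewrite lebesgue_measure_itv/=; case: ifP => _; rewrite ltry.
have e (c : R) : (b - a) * c = \int[@lebesgue_measure R]_(x in `]a, b]) c.
  rewrite Rintegral_cst//= lebesgue_measure_itv/= lte_fin mulrC.
  case: ifP => //= /negbT; rewrite -leNgt => ba.
  by rewrite (@le_anti _ _ a b) ?ab// subrr.
rewrite !e; apply/andP; split; apply: le_Rintegral => //; try exact: ic;
  by move=> x /=; rewrite in_itv/= => /andP[ax xb]; apply: h_alpha_le => //; lra.
Qed.

Lemma H_alpha_ge0 (R : realType) (alpha r : R) :
  0 < alpha -> 0 <= r -> 0 <= H_alpha alpha r.
Proof.
move=> a0 r0; have /andP[+ _] := H_alpha_sub a0 (lexx 0) r0.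
rewrite -[X in h_alpha _ X]/(0%:R) h_alpha_natr// powR0 ?gt_eqF// mulr0.
by rewrite H_alpha0 subr0.
Qed.

Lemma H_alpha_natr_le (R : realType) (alpha : R) (k : nat) :
  0 < alpha -> H_alpha alpha k%:R <= k%:R `^ (alpha + 1).
Proof.
move=> a0; have /andP[_] := H_alpha_sub a0 (lexx 0) (ler0n R k).
rewrite H_alpha0 !subr0 h_alpha_natr// mulrC => /le_trans; apply.
have a1 : 0 < alpha + 1 by lra.
by have := @mulr_powRB1 R k%:R _ (ler0n _ _) a1; rewrite addrK mulrC => ->.
Qed.

Lemma H_alpha_ge_half (R : realType) (alpha r : R) :
  1 <= alpha -> 0 <= r -> (r / 2) `^ (alpha + 1) <= H_alpha alpha r.
Proof.
move=> a1 r0; have a0 : 0 < alpha by lra.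
have r2 : 0 <= r / 2 by lra.
have r2r : r / 2 <= r by lra.
have /andP[+ _] := H_alpha_sub a0 r2 r2r.
have := H_alpha_ge0 a0 r2; rewrite /h_alpha a1/=.
have -> : r - r / 2 = r / 2 by field.
have a1' : 0 < alpha + 1 by lra.
by have := @mulr_powRB1 R (r / 2) _ r2 a1'; rewrite addrK => ->; lra.
Qed.

Section energy.
Context {R : realType} {I : nat}.
Variables (kappa : 'cV[R]_I) (alpha : R) (mu nu : 'cV[R]_I).
Hypotheses (alpha_gt0 : 0 < alpha) (kappa_pos : positive kappa).
Hypotheses (mu_pos : positive mu) (nu_pos : positive nu).

Definition lyap_weight (i : 'I_I) : R :=
  kappa i 0 * mu i 0 `^ (alpha - 1) * nu i 0 `^ (- alpha).

Definition energy (n : 'cV[R]_I) : R :=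
  \sum_(i < I) lyap_weight i * H_alpha alpha (n i 0).

Implicit Types n : 'cV[R]_I.

Local Notation L := (lyapunov kappa alpha mu nu).

Lemma lyap_weight_gt0 i : 0 < lyap_weight i.
Proof. by rewrite /lyap_weight !mulr_gt0// ?powR_gt0. Qed.

Lemma load_gt0 i : 0 < load mu nu i 0.
Proof. by rewrite mxE divr_gt0. Qed.

Lemma lyap_weight_mu i :
  lyap_weight i * mu i 0 = kappa i 0 * load mu nu i 0 `^ (- alpha).
Proof.
rewrite /lyap_weight mxE powRM ?invr_ge0 ?ltW//.
rewrite -[(mu i 0)^-1]powR_inv1 ?ltW// -powRrM mulN1r opprK.
rewrite -(@mulr_powRB1 _ (mu i 0) alpha) ?ltW//; ring.
Qed.

Lemma energy_ge0 n : (forall i, 0 <= n i 0) -> 0 <= energy n.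
Proof.
move=> n0; apply: sumr_ge0 => i _.
by rewrite mulr_ge0 ?H_alpha_ge0// ltW// lyap_weight_gt0.
Qed.

Lemma lyapunovE n : L n = ((alpha + 1) * energy n) `^ (1 / (alpha + 1)).
Proof. by []. Qed.

Lemma lyapunov_ge0 n : 0 <= L n.
Proof. exact: powR_ge0. Qed.

Lemma lyapunov_powR n : (forall i, 0 <= n i 0) ->
  L n `^ (alpha + 1) = (alpha + 1) * energy n.
Proof.
move=> n0; rewrite lyapunovE -powRrM mul1r mulVf ?gt_eqF ?addr_gt0//.
by rewrite powRr1// mulr_ge0 ?energy_ge0// addr_ge0// ltW.
Qed.

Lemma energy_gt0 n : (forall i, 0 <= n i 0) -> 0 < L n -> 0 < energy n.
Proof.
move=> n0 Ln; have := lyapunov_powR n0; have a0 := alpha_gt0; have a1 : 0 < alpha + 1 by lra.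
by move=> e; rewrite -(pmulr_rgt0 _ a1) -e powR_gt0.
Qed.

(* Tangent inequality: L is a concave power of the energy. *)
Lemma lyapunov_sub_le n (n' : 'cV[R]_I) :
  (forall i, 0 <= n i 0) -> (forall i, 0 <= n' i 0) -> 0 < L n ->
  L n' - L n <= L n `^ (- alpha) * (energy n' - energy n).
Proof.
move=> n0 n'0 Ln; have a0 := alpha_gt0; have a1 : 0 < alpha + 1 by lra.
have F0 := energy_gt0 n0 Ln; have F'0 := energy_ge0 n'0.
have p01 : 0 <= 1 / (alpha + 1) <= 1.
  by rewrite divr_ge0 ?(ltW a1)//= ler_pdivrMr//; lra.
have /(powR_concave_tangent p01) h : 0 < (alpha + 1) * energy n by rewrite mulr_gt0.
have {}h := h _ (mulr_ge0 (ltW a1) F'0); apply: le_trans h _.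
rewrite le_eqVlt lyapunovE -powRrM; apply/orP; left; apply/eqP.
have -> : 1 / (alpha + 1) * - alpha = 1 / (alpha + 1) - 1.
  by field; rewrite gt_eqF.
by field; rewrite gt_eqF.
Qed.

Lemma real_state_ge0 (s : state I) i : 0 <= real_state R s i 0.
Proof. by rewrite mxE. Qed.

Lemma energy_unit_sub (s : state I) i :
  lyap_weight i * (s i 0)%:R `^ alpha
  <= energy (real_state R (s + unit_state i)) - energy (real_state R s)
  <= lyap_weight i * ((s i 0)%:R + 1) `^ alpha.
Proof.
have -> : energy (real_state R (s + unit_state i)) - energy (real_state R s) =
    lyap_weight i * (H_alpha alpha (s i 0).+1%:R - H_alpha alpha (s i 0)%:R).
  rewrite /energy (bigD1 i)//= [X in _ - X](bigD1 i)//=.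
  rewrite (eq_bigr (fun k => lyap_weight k * H_alpha alpha (real_state R s k 0))).
    by rewrite !mxE !eqxx/= (_ : s i 0 + _ = (s i 0).+1)%R; [ring|exact: addn1].
  by move=> k ki; rewrite !mxE (negbTE ki) addr0.
have := lyap_weight_gt0 i; move: (s i 0) (lyap_weight i) => k w w0.
have kk : k%:R <= k.+1%:R :> R by rewrite ler_nat.
rewrite !(ler_pM2l w0).
have := H_alpha_sub alpha_gt0 (ler0n R k) kk.
by rewrite !h_alpha_natr// -natrB// subSnn !mul1r natr1.
Qed.

Definition removed (s : state I) (i : 'I_I) : state I :=
  \col_k (s k ord0 - (k == i))%N.

Lemma removedK (s : state I) i : (0 < s i ord0)%N -> removed s i + unit_state i = s.
Proof.
move=> s0; apply/matrixP => k j; rewrite !mxE (ord1 j) eqxx andbT.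
by have [->|] := eqVneq k i; [exact: subnK|rewrite subn0 addr0].
Qed.

Local Notation m := (Num.max alpha 1).

Lemma drift_le (lam : 'I_I -> R) (s : state I) :
  (forall i, 0 <= lam i) -> (forall i, s i 0 = 0%N -> lam i = 0) ->
  0 < L (real_state R s) ->
  \sum_i nu i 0 * (L (real_state R (s + unit_state i)) - L (real_state R s)) +
  \sum_(i | (0 < s i ord0)%N)
     mu i 0 * lam i * (L (real_state R (removed s i)) - L (real_state R s)) <=
  L (real_state R s) `^ (- alpha) *
  (\sum_i lyap_weight i * (s i 0)%:R `^ alpha * (nu i 0 - mu i 0 * lam i) +
   \sum_i lyap_weight i * (nu i 0 + mu i 0 * lam i) *
      (m * ((s i 0)%:R + 1) `^ (m - 1))).
Proof.
move=> lam0 lamE Ls; set D := L _ `^ _.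
have D0 : 0 < D by rewrite powR_gt0.
rewrite [X in _ + X <= _]big_mkcond/= -!big_split/= mulr_sumr.
apply: ler_sum => i _.
have w0 := lyap_weight_gt0 i; have mu0 := mu_pos i; have nu0 := nu_pos i.
set x := (s i 0)%:R; set M := _ * _ `^ (m - 1).
have x0 : 0 <= x by rewrite ler0n.
have M0 : 0 <= M.
  by rewrite mulr_ge0 ?powR_ge0// le_max ler01 orbT.
have up : L (real_state R (s + unit_state i)) - L (real_state R s) <=
    D * (lyap_weight i * (x `^ alpha + M)).
  apply: le_trans (lyapunov_sub_le (real_state_ge0 _) (real_state_ge0 _) Ls) _.
  rewrite ler_pM2l//; have /andP[_ h] := energy_unit_sub s i.
  apply: le_trans h _; rewrite ler_pM2l//.
  by have := powR_increment_le alpha_gt0 x0; rewrite -/M -/x; lra.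
apply: (@le_trans _ _ (D * (lyap_weight i * nu i 0 * (x `^ alpha + M)) +
   D * (lyap_weight i * (mu i 0 * lam i) * (M - x `^ alpha)))); last first.
  by rewrite le_eqVlt; apply/orP; left; apply/eqP; ring.
apply: lerD.
  apply: le_trans (ler_wpM2l (ltW nu0) up) _.
  by rewrite le_eqVlt; apply/orP; left; apply/eqP; ring.
case: ifPn => [si|]; last first.
  by rewrite lt0n negbK => /eqP/lamE ->; rewrite mulr0 mulr0 mul0r mulr0.
have down : L (real_state R (removed s i)) - L (real_state R s) <=
    D * (lyap_weight i * (M - x `^ alpha)).
  apply: le_trans (lyapunov_sub_le (real_state_ge0 _) (real_state_ge0 _) Ls) _.
  rewrite ler_pM2l//; have /andP[h _] := energy_unit_sub (removed s i) i.
  move: h; rewrite removedK// !mxE eqxx natrB// -/x => h.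
  have x1 : 0 <= x - 1 by rewrite subr_ge0 ler1n.
  have := powR_increment_le alpha_gt0 x1; rewrite subrK => h1.
  have h2 : m * x `^ (m - 1) <= M.
    have m1 : 1 <= m by rewrite le_max lexx orbT.
    rewrite /M ler_pM2l ?(lt_le_trans ltr01 m1)//.
    by rewrite ge0_ler_powR ?nnegrE ?subr_ge0// ?lerDl// addr_ge0.
  have : lyap_weight i * (x `^ alpha - M) <= lyap_weight i * (x - 1) `^ alpha.
    by rewrite ler_pM2l// lerBlDr -lerBlDl (le_trans h1 h2).
  by move=> h3; rewrite -[leLHS]opprB lerNl -mulrN opprB (le_trans h3 h).
apply: le_trans (ler_wpM2l _ down) _; first by rewrite mulr_ge0// ltW.
by rewrite le_eqVlt; apply/orP; left; apply/eqP; ring.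
Qed.

Lemma lyapunov_le_sup (s : state I) (t : R) : 0 <= t ->
  (forall i, (s i 0)%:R <= t) ->
  L (real_state R s) <= ((alpha + 1) * \sum_i lyap_weight i) `^ (1 / (alpha + 1)) * t.
Proof.
move=> t0 st; have a0 := alpha_gt0; have a1 : 0 < alpha + 1 by lra.
have w0 : 0 <= \sum_i lyap_weight i.
  by apply: sumr_ge0 => i _; rewrite ltW// lyap_weight_gt0.
rewrite -[t in leRHS]powRr1// -[X in t `^ X](@mulfV _ (alpha + 1)) ?gt_eqF//.
rewrite lyapunovE !div1r powRrM -powRM ?powR_ge0 ?(mulr_ge0 (ltW a1))//.
rewrite ge0_ler_powR ?nnegrE ?invr_ge0 ?(ltW a1)//.
- by rewrite mulr_ge0 ?(ltW a1)// energy_ge0// => i; exact: real_state_ge0.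
- by rewrite !mulr_ge0 ?powR_ge0// ltW.
rewrite -mulrA ler_pM2l// mulr_suml; apply: ler_sum => i _.
rewrite ler_pM2l ?lyap_weight_gt0// mxE.
apply: le_trans (H_alpha_natr_le _ alpha_gt0) _.
by rewrite ge0_ler_powR ?nnegrE// ltW.
Qed.

(* The weighted sum S of the n_i^alpha bounds each n_i by (V S)^(1/alpha). *)
Lemma lyapunov_powR_le (s : state I) :
  L (real_state R s) `^ alpha <=
  ((alpha + 1) * \sum_i lyap_weight i) `^ (alpha / (alpha + 1)) *
  (\sum_i (lyap_weight i * nu i 0)^-1) *
  \sum_i lyap_weight i * nu i 0 * (s i 0)%:R `^ alpha.
Proof.
set V := \sum_i _^-1; set S := \sum_i _ * _ `^ alpha.
have wn i : 0 < lyap_weight i * nu i 0 by rewrite mulr_gt0 ?lyap_weight_gt0.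
have V0 : 0 <= V by apply: sumr_ge0 => i _; rewrite invr_ge0 ltW.
have S0 : 0 <= S by apply: sumr_ge0 => i _; rewrite mulr_ge0 ?powR_ge0// ltW.
have st i : (s i 0)%:R <= (V * S) `^ alpha^-1.
  rewrite -[leLHS]powRr1// -[X in _ `^ X](@mulfV _ alpha) ?gt_eqF//.
  rewrite powRrM ge0_ler_powR ?nnegrE ?powR_ge0 ?invr_ge0 ?mulr_ge0 ?(ltW alpha_gt0)//.
  apply: (@le_trans _ _ ((lyap_weight i * nu i 0)^-1 *
      (lyap_weight i * nu i 0 * (s i 0)%:R `^ alpha))).
    by rewrite mulKf ?gt_eqF.
  have pos k : 0 <= lyap_weight k * nu k 0 * (s k 0)%:R `^ alpha.
    by rewrite mulr_ge0 ?powR_ge0// ltW.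
  apply: ler_pM; rewrite ?invr_ge0 ?(ltW (wn i))//.
    rewrite /V (bigD1 i)//= lerDl; apply: sumr_ge0 => k _.
    by rewrite invr_ge0 ltW.
  by rewrite /S (bigD1 i)//= lerDl; apply: sumr_ge0 => k _.
have h := lyapunov_le_sup (powR_ge0 _ _) st.
clearbody V S; clear st.
have {h} := @ge0_ler_powR _ alpha (ltW alpha_gt0) _ _ _ _ h.
rewrite !nnegrE powR_ge0 mulr_ge0 ?powR_ge0// => /(_ isT isT) /le_trans; apply.
have VS : ((V * S) `^ alpha^-1) `^ alpha = V * S.
  by rewrite -powRrM mulVf ?gt_eqF// powRr1 ?mulr_ge0.
rewrite powRM ?powR_ge0// VS -powRrM.
by rewrite div1r [_^-1 * _]mulrC mulrA.
Qed.

Lemma state_le_lyapunov (s : state I) : 1 <= alpha ->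
  0 < L (real_state R s) -> forall i,
  (s i 0)%:R + 1 <=
  2 * (2 * \sum_k lyap_weight k `^ (- (1 / (alpha + 1)))) * L (real_state R s).
Proof.
move=> al1 Ls i; have a0 := alpha_gt0; have a1 : 0 < alpha + 1 by lra.
set c := 2 * \sum_k _.
have h k : (s k 0)%:R <= c * L (real_state R s).
  have w0 := lyap_weight_gt0 k.
  have h1 : lyap_weight k * ((s k 0)%:R / 2) `^ (alpha + 1) <=
      L (real_state R s) `^ (alpha + 1).
    rewrite lyapunov_powR; last by move=> ?; exact: real_state_ge0.
    apply: (@le_trans _ _ (energy (real_state R s))); last first.
      have : 0 <= energy (real_state R s) by apply: energy_ge0 => ?; exact: real_state_ge0.
      nra.
    rewrite /energy (bigD1 k)//= ler_wpDr//.
      apply: sumr_ge0 => j _; rewrite mulr_ge0 ?(ltW (lyap_weight_gt0 _))//.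
      by rewrite H_alpha_ge0// real_state_ge0.
    by rewrite ler_pM2l// mxE H_alpha_ge_half.
  have h2 : (s k 0)%:R / 2 <= lyap_weight k `^ (- (1 / (alpha + 1))) * L (real_state R s).
    have K (y : R) : 0 <= y -> (y `^ (alpha + 1)) `^ (1 / (alpha + 1)) = y.
      by move=> y0; rewrite div1r -powRrM mulfV ?gt_eqF// powRr1.
    have x0 : 0 <= (s k 0)%:R / 2 :> R by rewrite divr_ge0.
    rewrite -[leLHS](K _ x0) -[L _ in leRHS]K ?lyapunov_ge0//.
    rewrite -mulN1r [X in _ <= X * _]powRrM powR_inv1 ?(ltW w0)//.
    rewrite -powRM ?powR_ge0 ?invr_ge0 ?(ltW w0)//.
    rewrite ge0_ler_powR ?nnegrE ?powR_ge0 ?div1r ?invr_ge0 ?(ltW a1)//.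
      by rewrite mulr_ge0 ?powR_ge0// invr_ge0 ltW.
    by rewrite [leRHS]mulrC ler_pdivlMr// mulrC.
  have h3 : lyap_weight k `^ (- (1 / (alpha + 1))) <=
      \sum_k lyap_weight k `^ (- (1 / (alpha + 1))).
    by rewrite (bigD1 k)//= lerDl; apply: sumr_ge0 => j _; rewrite powR_ge0.
  have := ler_wpM2r (ltW Ls) h3.
  rewrite /c; lra.
suff : 1 <= c * L (real_state R s) by have := h i; lra.
have [[k sk]|] := pselect (exists k, (0 < s k ord0)%N).
  by apply: le_trans (h k); rewrite ler1n.
move=> /forallNP s0; have := energy_gt0 (@real_state_ge0 s) Ls.
rewrite /energy big1 ?ltxx// => k _; have /negP := s0 k.
by rewrite lt0n negbK mxE => /eqP ->; rewrite H_alpha0 mulr0.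
Qed.

End energy.

Lemma alpha_fair_variational (R : realType) (J I : nat) (A : 'M[R]_(J, I))
    (C : 'cV[R]_J) (kappa : 'cV[R]_I) (alpha : R)
    (Lambda : 'cV[R]_I -> 'cV[R]_I) (n y : 'cV[R]_I) :
  0 < alpha -> positive kappa -> alpha_fair A C kappa alpha Lambda ->
  (forall i, 0 <= n i 0) -> n != 0 -> feasible A C n y -> positive y ->
  0 <= \sum_i kappa i 0 * n i 0 `^ alpha *
          (y i 0 `^ (- alpha) * (Lambda n i 0 - y i 0)).
Proof.
move=> a0 kappa_pos fair n0 nn0 fy y_pos.
have [lam0 /(_ nn0)[[feas _] opt]] := fair n n0.
pose U i := fine (utility alpha (y i ord0)).
have UE i : utility alpha (y i ord0) = (U i)%:E.
  by rewrite fineK//; have [] := utility_tangent a0 (lexx 0) (y_pos i).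
have ub : (objective kappa alpha n (Lambda n) <= (\sum_(i < I | (0 < n i ord0)%R)
    (kappa i ord0 * n i ord0 `^ alpha *
    (U i + y i ord0 `^ (- alpha) * (Lambda n i ord0 - y i ord0)))%:E))%E.
  apply: lee_sum => i ni; rewrite [leRHS]EFinM.
  apply: lee_wpmul2l; first by rewrite lee_fin mulr_ge0 ?powR_ge0// ltW.
  by rewrite EFinD -UE; have [] := utility_tangent a0 (feas _ ni) (y_pos i).
have := le_trans (opt y fy) ub; rewrite /objective.
under eq_bigr do rewrite UE -EFinM.
rewrite !sumEFin lee_fin -subr_ge0 -sumrB => h.
rewrite (bigID (fun i => 0 < n i 0))/= [X in _ + X]big1 ?addr0.
  by apply: le_trans h _; rewrite le_eqVlt; apply/orP; left; apply/eqP;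
     apply: eq_bigr => i _; ring.
move=> i; rewrite -leNgt => ni.
by rewrite (@le_anti _ _ (n i 0) 0) ?ni ?n0// powR0 ?gt_eqF// mulr0 mul0r.
Qed.

Lemma gap_spec (R : realType) (J I : nat) (A : 'M[R]_(J, I)) (C : 'cV[R]_J)
    (rho : 'cV[R]_I) :
  (forall j, 0 <= (A *m rho) j 0 < C j 0) -> (exists j, 0 < (A *m rho) j 0) ->
  0 < gap A C rho /\ forall j, (1 + gap A C rho) * (A *m rho) j 0 <= C j 0.
Proof.
set a := A *m rho => aC [j0 aj0]; rewrite /gap -/a; set E := [set e | _].
have a0 j : 0 <= a j 0 by have /andP[] := aC j.
have ac j : a j 0 < C j 0 by have /andP[] := aC j.
pose e := \big[Num.min/1]_(j < J) ((C j 0 - a j 0) / (a j 0 + 1)).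
have e0 : 0 < e.
  rewrite /e; apply: lt_bigmin => // j _.
  by rewrite divr_gt0 ?subr_gt0// ltr_wpDl.
have Ee : E e.
  split=> // j; have : e <= (C j 0 - a j 0) / (a j 0 + 1) by exact: bigmin_le.
  have := a0 j; rewrite ler_pdivlMr ?ltr_wpDl// => a0j; nra.
have ubE j x : 0 < a j 0 -> E x -> x <= C j 0 / a j 0 - 1.
  move=> aj [_ /(_ j)]; rewrite -ler_pdivlMr//; lra.
have supE : has_sup E by split; [exists e|exists (C j0 0 / a j0 0 - 1) => x /ubE; exact].
split; first by apply: lt_le_trans e0 _; exact: ub_le_sup (supE.2) _ Ee.
move=> j; have [aj|aj] := ltP 0 (a j 0); last first.
  have -> : a j 0 = 0 by apply/le_anti; rewrite aj a0.
  by rewrite mulr0 ltW// (le_lt_trans _ (ac j)).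
rewrite -ler_pdivlMr// -lerBrDl; apply: ge_sup; first by exists e.
by move=> x; exact: ubE.
Qed.

Section drift.
Context {R : realType} {J I : nat}.
Variables (route : 'I_I -> {set 'I_J}) (C : 'cV[R]_J).
Variables (kappa : 'cV[R]_I) (alpha : R) (mu nu : 'cV[R]_I).
Variables (Lambda : 'cV[R]_I -> 'cV[R]_I).
Hypotheses (I_gt0 : (0 < I)%N) (route_neq0 : forall i, route i != finset.set0).
Hypotheses (alpha_gt0 : 0 < alpha) (kappa_pos : positive kappa).
Hypotheses (mu_pos : positive mu) (nu_pos : positive nu).
Hypothesis fair : alpha_fair (incidence R route) C kappa alpha Lambda.
Hypothesis stable : forall j, (incidence R route *m load mu nu) j 0 < C j 0.

Local Notation A := (incidence R route).
Local Notation rho := (load mu nu).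
Local Notation eps := (gap A C rho).
Local Notation L := (lyapunov kappa alpha mu nu).
Local Notation w := (lyap_weight kappa alpha mu nu).
Local Notation m := (Num.max alpha 1).
Local Notation Cmax := (\big[Num.max/0]_(j < J) C j 0).

Lemma gap_load : 0 < eps /\ forall j, (1 + eps) * (A *m rho) j 0 <= C j 0.
Proof.
have rho0 i : 0 < rho i 0 by exact: load_gt0.
apply: gap_spec => [j|].
  rewrite stable andbT mxE; apply: sumr_ge0 => i _.
  by rewrite mulr_ge0 ?(ltW (rho0 _))// mxE ler0n.
pose i := Ordinal I_gt0; have /set0Pn[j ji] := route_neq0 i.
exists j; rewrite mxE (bigD1 i)//= ltr_wpDr//; last first.
  by rewrite mulr_gt0// mxE ji.
by apply: sumr_ge0 => k _; rewrite mulr_ge0 ?(ltW (rho0 _))// mxE ler0n.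
Qed.

Lemma Lambda_bounds (n : 'cV[R]_I) i : (forall k, 0 <= n k 0) -> n != 0 ->
  0 <= Lambda n i 0 <= Cmax.
Proof.
move=> n0 nn0; have [lam0 /(_ nn0)[[feas cap] _]] := fair n0.
have Cmax0 : 0 <= Cmax by rewrite bigmax_ge_id.
have [ni|ni] := boolP (0 < n i 0); last by rewrite lam0// lexx.
rewrite feas//=; have /set0Pn[j ji] := route_neq0 i.
apply: le_trans (le_bigmax _ _ j); apply: le_trans (cap j).
rewrite (bigD1 i)//= mxE ji mul1r lerDl; apply: sumr_ge0 => k /andP[nk _].
by rewrite mulr_ge0 ?feas// mxE ler0n.
Qed.

Lemma first_order_drift (n : 'cV[R]_I) : (forall k, 0 <= n k 0) -> n != 0 ->
  \sum_i w i * n i 0 `^ alpha * (nu i 0 - mu i 0 * Lambda n i 0) <=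
  - eps * \sum_i w i * nu i 0 * n i 0 `^ alpha.
Proof.
move=> n0 nn0; have [eps0 feas] := gap_load.
have e1 : 0 < 1 + eps by rewrite addr_gt0.
have rho0 i : 0 < rho i 0 by exact: load_gt0.
pose y := (1 + eps) *: rho.
have y_pos : positive y by move=> i; rewrite mxE mulr_gt0.
have fy : feasible A C n y.
  split=> [i _|j]; first by rewrite ltW.
  apply: le_trans (feas j); rewrite [(_ *m _) j 0]mxE mulr_sumr.
  rewrite [leRHS](bigID (fun i => 0 < n i 0))/= ler_wpDr//.
    apply: sumr_ge0 => i _.
    by rewrite !mulr_ge0 ?(ltW e1) ?(ltW (rho0 _))// mxE ler0n.
  by apply: ler_sum => i _; rewrite [y i 0]mxE mulrCA.
have := alpha_fair_variational alpha_gt0 kappa_pos fair n0 nn0 fy y_pos.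
have e (i : 'I_I) : kappa i 0 * n i 0 `^ alpha *
    (y i 0 `^ (- alpha) * (Lambda n i 0 - y i 0)) =
  (1 + eps) `^ (- alpha) * (- (w i * n i 0 `^ alpha * (nu i 0 - mu i 0 * Lambda n i 0))
   - eps * (w i * nu i 0 * n i 0 `^ alpha)).
  rewrite [y i 0]mxE powRM ?(ltW e1) ?(ltW (rho0 _))//.
  have -> : nu i 0 = mu i 0 * rho i 0 by rewrite mxE mulrC divfK// gt_eqF.
  transitivity ((1 + eps) `^ (- alpha) * n i 0 `^ alpha *
    (kappa i 0 * rho i 0 `^ (- alpha)) * (Lambda n i 0 - (1 + eps) * rho i 0)).
    by ring.
  rewrite -lyap_weight_mu//; ring.
rewrite (eq_bigr _ (fun i _ => e i)) -mulr_sumr pmulr_rge0 ?powR_gt0//.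
by rewrite big_split/= !sumrN -mulr_sumr mulNr => h; rewrite -subr_ge0 addrC.
Qed.

Definition lyap_slope : R :=
  ((alpha + 1) * \sum_i w i) `^ (alpha / (alpha + 1)) * \sum_i (w i * nu i 0)^-1.

Definition lyap_noise : R :=
  m * (\sum_i w i * (nu i 0 + mu i 0 * Cmax)) *
  (2 * (2 * \sum_i w i `^ (- (1 / (alpha + 1))))) `^ (m - 1).

Definition lyap_threshold : R :=
  if 1 <= alpha then 2 * lyap_slope * lyap_noise
  else (2 * lyap_slope * lyap_noise) `^ (1 / alpha).

Lemma sum_ord_gt0 (F : 'I_I -> R) : (forall i, 0 < F i) -> 0 < \sum_i F i.
Proof.
move=> F0; rewrite (bigD1 (Ordinal I_gt0))//= ltr_pwDl//.
by apply: sumr_ge0 => i _; exact: ltW.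
Qed.

Lemma Cmax_ge0 : 0 <= Cmax. Proof. by rewrite bigmax_ge_id. Qed.

Lemma Xi_gt0 : 0 < Xi C mu nu.
Proof.
by apply: sum_ord_gt0 => i; rewrite ltr_pwDl// mulr_ge0 ?Cmax_ge0// ltW.
Qed.

Lemma lyap_slope_gt0 : 0 < lyap_slope.
Proof.
have a1 : 0 < alpha + 1 by rewrite addr_gt0.
rewrite /lyap_slope mulr_gt0//.
  by rewrite powR_gt0// mulr_gt0// sum_ord_gt0// => i; exact: lyap_weight_gt0.
by apply: sum_ord_gt0 => i; rewrite invr_gt0 mulr_gt0// lyap_weight_gt0.
Qed.

Lemma lyap_noise_gt0 : 0 < lyap_noise.
Proof.
rewrite /lyap_noise mulr_gt0//.
  rewrite mulr_gt0 ?lt_max ?ltr01 ?orbT//; apply: sum_ord_gt0 => i.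
  by rewrite mulr_gt0 ?lyap_weight_gt0// ltr_pwDl// mulr_ge0 ?Cmax_ge0// ltW.
rewrite powR_gt0// !mulr_gt0//; apply: sum_ord_gt0 => i.
by rewrite powR_gt0// lyap_weight_gt0.
Qed.

Lemma lyap_threshold_gt0 : 0 < lyap_threshold.
Proof.
have h : 0 < 2 * lyap_slope * lyap_noise.
  by rewrite (mulr_gt0 (mulr_gt0 _ lyap_slope_gt0) lyap_noise_gt0).
by rewrite /lyap_threshold; case: ifP => // _; rewrite powR_gt0.
Qed.

Lemma second_order_drift (s : state I) : 0 < L (real_state R s) ->
  (forall i, Lambda (real_state R s) i 0 <= Cmax) ->
  \sum_i w i * (nu i 0 + mu i 0 * Lambda (real_state R s) i 0) *
      (m * ((s i 0)%:R + 1) `^ (m - 1)) <=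
  lyap_noise * L (real_state R s) `^ (m - 1).
Proof.
move=> Ls lamC; set l := L _; set c := 2 * (2 * \sum_i w i `^ (- (1 / (alpha + 1)))).
have c0 : 0 <= c.
  by rewrite !mulr_ge0//; apply: sumr_ge0 => i _; rewrite powR_ge0.
have m1 : 1 <= m by rewrite le_max lexx orbT.
have m0 : 0 <= m by rewrite (le_trans ler01).
have h i : ((s i 0)%:R + 1) `^ (m - 1) <= (c * l) `^ (m - 1).
  have [a1|a1] := leP 1 alpha; last by rewrite subrr !powRr0.
  rewrite ge0_ler_powR ?nnegrE ?subr_ge0 ?addr_ge0 ?(mulr_ge0 c0 (ltW Ls))//.
  exact: (state_le_lyapunov alpha_gt0 kappa_pos mu_pos nu_pos a1 Ls i).
rewrite /lyap_noise -/c -[leRHS]mulrA -powRM ?(ltW Ls)// -[leRHS]mulrA.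
rewrite [leRHS]mulrCA mulr_suml.
apply: ler_sum => i _; have w0 : 0 < w i by exact: lyap_weight_gt0.
have nu0 := nu_pos i; have mu0 := mu_pos i.
apply: (@le_trans _ _ (w i * (nu i 0 + mu i 0 * Cmax) * (m * ((s i 0)%:R + 1) `^ (m - 1)))).
  rewrite ler_wpM2r ?mulr_ge0 ?powR_ge0//.
  by rewrite ler_pM2l// lerD2l ler_pM2l.
apply: ler_wpM2l; last by rewrite ler_wpM2l.
by rewrite mulr_ge0 ?(ltW w0)// addr_ge0 ?(ltW nu0)// mulr_ge0 ?Cmax_ge0// ltW.
Qed.

Lemma noise_le (l : R) : 0 < l ->
  (if 1 <= alpha then lyap_threshold / eps
   else lyap_threshold / Num.min (eps `^ (1 / alpha)) eps) < l ->
  l `^ (- alpha) * (lyap_noise * l `^ (m - 1)) <= eps / (2 * lyap_slope).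
Proof.
move=> l0; have [eps0 _] := gap_load.
have S0 := lyap_slope_gt0; have N0 := lyap_noise_gt0.
rewrite mulrCA -powRD ?(gt_eqF l0) ?implybT// /lyap_threshold.
have SN : 0 < 2 * lyap_slope * lyap_noise by rewrite (mulr_gt0 (mulr_gt0 _ S0) N0).
have S2 : 0 < 2 * lyap_slope by rewrite (mulr_gt0 _ S0).
have key x : 0 < x -> 2 * lyap_slope * lyap_noise <= x * eps ->
    lyap_noise * x^-1 <= eps / (2 * lyap_slope).
  move=> x0 h; rewrite ler_pdivrMr// mulrAC ler_pdivlMr//.
  by rewrite [leLHS]mulrC [leRHS]mulrC.
have [a1|a1] := leP 1 alpha => lB.
  rewrite addKr powR_inv1 ?(ltW l0)//.
  by apply: key => //; rewrite -ler_pdivrMr// ltW.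
rewrite subrr addr0 powRN; apply: key; rewrite ?powR_gt0//.
have e1 : 0 < eps `^ (1 / alpha) by rewrite powR_gt0.
have h : (2 * lyap_slope * lyap_noise) `^ (1 / alpha) <= l * eps `^ (1 / alpha).
  rewrite -ler_pdivrMr//; apply: le_trans (ltW lB).
  by rewrite ler_pM2l ?powR_gt0// lef_pV2 ?posrE ?lt_min ?e1// ge_min lexx.
have K x : 0 <= x -> (x `^ (1 / alpha)) `^ alpha = x.
  by move=> x0; rewrite -powRrM mul1r mulVf ?gt_eqF// powRr1.
rewrite -(K _ (ltW SN)) -[X in _ <= _ * X](K _ (ltW eps0)) -powRM ?powR_ge0 ?(ltW l0)//.
rewrite ge0_ler_powR ?nnegrE ?powR_ge0 ?(ltW alpha_gt0)//.
by rewrite mulr_ge0 ?powR_ge0// ltW.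
Qed.

Lemma lyapunov_drift (s : state I) :
  (if 1 <= alpha then lyap_threshold / eps
   else lyap_threshold / Num.min (eps `^ (1 / alpha)) eps) <
    L (real_state R s) ->
  \sum_i nu i 0 * (L (real_state R (s + unit_state i)) - L (real_state R s)) +
  \sum_(i | (0 < s i ord0)%N)
     mu i 0 * Lambda (real_state R s) i 0 *
       (L (real_state R (removed s i)) - L (real_state R s)) <=
  - (eps / (2 * lyap_slope)).
Proof.
move=> lB; have [eps0 _] := gap_load.
have S0 := lyap_slope_gt0; have T0 := lyap_threshold_gt0.
set n := real_state R s; have Ls : 0 < L n.
  apply: le_lt_trans lB; case: ifP => _; rewrite divr_ge0 ?(ltW T0) ?(ltW eps0)//.
  by rewrite le_min powR_ge0 ltW.
have n0 k : 0 <= n k 0 by exact: real_state_ge0.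
have nn0 : n != 0.
  apply/eqP => n_eq0; have := energy_gt0 alpha_gt0 kappa_pos mu_pos nu_pos n0 Ls.
  by rewrite /energy big1 ?ltxx// => k _; rewrite n_eq0 mxE H_alpha0 mulr0.
have lam_bd i := Lambda_bounds i n0 nn0.
apply: le_trans (drift_le alpha_gt0 kappa_pos mu_pos nu_pos _ _ Ls) _.
- by move=> i; have /andP[] := lam_bd i.
- by move=> i si; have [-> //] := fair n0; rewrite mxE si ltxx.
have fo := first_order_drift n0 nn0.
have so : _ <= _ := @second_order_drift s Ls (fun i => proj2 (andP (lam_bd i))).
have {}fo : \sum_i w i * (s i 0)%:R `^ alpha * (nu i 0 - mu i 0 * Lambda n i 0) <=
    - eps * \sum_i w i * nu i 0 * (s i 0)%:R `^ alpha.
  apply: le_trans (le_trans fo _); rewrite le_eqVlt; apply/orP; left; apply/eqP.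
    by apply: eq_bigr => i _; rewrite [n i 0]mxE.
  by congr (_ * _); apply: eq_bigr => i _; rewrite [n i 0]mxE.
have D0 : 0 < L n `^ (- alpha) by rewrite powR_gt0.
apply: le_trans (ler_wpM2l (ltW D0) (lerD fo so)) _; rewrite mulrDr.
have := noise_le Ls lB.
have : lyap_slope^-1 <= L n `^ (- alpha) *
    \sum_i w i * nu i 0 * (s i 0)%:R `^ alpha.
  rewrite powRN ler_pdivlMl ?(powR_gt0 _ Ls)// ler_pdivrMr// [leRHS]mulrC.
  exact: lyapunov_powR_le.
set S := \sum_i _; set D := _ `^ _; set N := _ * (_ * _) => h1 h2.
have -> : D * (- eps * S) = - (eps * (D * S)) by ring.
have {}h1 : eps / lyap_slope <= eps * (D * S) by rewrite ler_pM2l.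
have -> : - (eps / (2 * lyap_slope)) =
    - (eps / lyap_slope) + eps / (2 * lyap_slope).
  by field; rewrite gt_eqF.
by apply: lerD; rewrite ?lerN2.
Qed.

End drift.

Section markov_chain_step.
Context d (T : measurableType d) (R : realType) (P : probability T R).
Context (S : countType) (p : S -> S -> R) (N : nat -> T -> S).
Hypothesis chainN : markov_chain P p N.

Let mN t s : measurable (N t @^-1` [set s]).
Proof. by have [] := chainN. Qed.

(* The paths up to time t form a countable set, so the events
   "the path up to time t has code k" partition the probability space. *)
Lemma markov_step t s s' :
  P (N t @^-1` [set s] `&` N t.+1 @^-1` [set s']) =
  (P (N t @^-1` [set s]) * (p s s')%:E)%E.
Proof.
pose path w := [seq N k w | k <- iota 0 t.+1].
pose F k := [set w | pickle (path w) = k].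
pose E := N t @^-1` [set s]; pose E' := N t.+1 @^-1` [set s'].
have FE w0 : F (pickle (path w0)) = \bigcap_(k in `I_t.+1) N k @^-1` [set N k w0].
  apply/seteqP; split => w.
    move=> /(pcan_inj pickleK)/eq_in_map h k kt; apply: h.
    by rewrite mem_iota add0n.
  move=> h; congr pickle; apply/eq_in_map => k.
  by rewrite mem_iota add0n => kt; exact: h.
have mcap (x : nat -> S) : measurable (\bigcap_(k in `I_t.+1) N k @^-1` [set x k]).
  by apply: bigcap_measurableType => k _; exact: mN.
have mF k : measurable (F k).
  have [[w0 <-]|/forallNP F0] := pselect (exists w0, pickle (path w0) = k).
    by rewrite FE.
  by rewrite (_ : F k = set0)//; apply/seteqP; split => // w /F0.
have FEE' k : P (F k `&` (E `&` E')) = (P (F k `&` E) * (p s s')%:E)%E.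
  have [[w0 [<- Ew0]]|/forallNP F0] := pselect (exists w0, pickle (path w0) = k /\ E w0).
    pose x j := if (j <= t)%N then N j w0 else s'.
    have xE : \bigcap_(j in `I_t.+1) N j @^-1` [set x j] = F (pickle (path w0)) `&` E.
      rewrite FE; apply/seteqP; split => [w h|w [h _] j jt].
        have {}h j : (j < t.+1)%N -> N j w = N j w0.
          by move=> jt; have := h j jt; rewrite /= /x -ltnS jt.
        by split=> //; rewrite /E/= h.
      by rewrite /= /x -ltnS jt; exact: h.
    have xt : x t = s by rewrite /x leqnn.
    have xt1 : x t.+1 = s' by rewrite /x ltnn.
    have := chainN.2 t x; rewrite xE xt xt1 => <-.
    congr (P _); rewrite setIA -xE; apply/seteqP; split => [w [h Ew] j|w h].
      rewrite /= ltnS leq_eqVlt => /predU1P[->|]; first by rewrite xt1.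
      exact: h.
    split=> [j jt|]; first by apply: h; rewrite /= ltnW.
    by have := h t.+1 (ltnSn _); rewrite /= xt1.
  rewrite setIA (_ : F k `&` E = set0) ?set0I ?measure0 ?mul0e//.
  by apply/seteqP; split => // w [Fw Ew]; apply: (F0 w).
have tF (X : set T) : trivIset setT (fun k => F k `&` X).
  apply/trivIsetP => i j _ _ /eqP ij; apply/seteqP.
  by split=> // w [[Fi _] [Fj _]]; apply: ij; rewrite -Fi -Fj.
have cvF (X : set T) : measurable X ->
    (fun n => \sum_(0 <= k < n) P (F k `&` X))%E @ \oo --> P X.
  move=> mX; rewrite [X in _ --> P X](_ : X = \bigcup_k (F k `&` X)); last first.
    apply/seteqP; split=> [w Xw|w [k _ []//]].
    by exists (pickle (path w)).
  apply: measure_semi_sigma_additive => //.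
    by move=> k; exact: measurableI.
  by apply: bigcup_measurable => k _; exact: measurableI.
have := cvF _ (measurableI _ _ (mN t s) (mN t.+1 s')).
under eq_fun do under eq_bigr do rewrite FEE'.
under eq_fun do rewrite -ge0_sume_distrl//.
move=> /cvg_unique -/(_ (@ereal_hausdorff R)); apply.
by apply: cvgeZr => //; exact: cvF (mN t s).
Qed.

Let measurable_obs t (f : S -> R) (D : set T) :
  measurable_fun D (fun w => f (N t w)).
Proof.
apply: measurable_funTS => _ Y _; rewrite setTI.
rewrite (_ : _ @^-1` _ = \bigcup_(s in [set s | Y (f s)]) N t @^-1` [set s]).
  rewrite bigcup_mkcond; apply: countable_bigcupT_measurable => //.
  by move=> s; case: ifP => _.
apply/seteqP; split=> [w Yw|w [s Ys ws]]; first by exists (N t w).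
by rewrite /= (ws : N t w = s).
Qed.

Lemma cond_expectation_step t s (nb : seq S) (f : S -> R) (X : T -> R) :
  (0 < P (N t @^-1` [set s]))%E -> uniq nb -> \sum_(s' <- nb) p s s' = 1 ->
  (forall w, N t w = s -> X w = f (N t.+1 w)) ->
  cond_expectation P X (N t @^-1` [set s]) =
  (\sum_(s' <- nb) p s s' * f s')%:E.
Proof.
set E := N t @^-1` [set s] => PE unb p1 XE.
have mE : measurable E by exact: mN.
pose Es s' := E `&` N t.+1 @^-1` [set s'].
have mEs s' : measurable (Es s') by exact: measurableI.
have tEs : trivIset [set` nb] Es.
  apply/trivIsetP => i j _ _ /eqP ij; apply/seteqP.
  by split=> // w [[_ wi] [_ wj]]; apply: ij; rewrite -wi -wj.
have PEfin : P E = (fine (P E))%:E by rewrite fineK// fin_num_measure.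
have PE0 : 0 < fine (P E) by rewrite -lte_fin -PEfin.
pose U := \big[setU/set0]_(s' <- nb) Es s'.
have mU : measurable U by apply: bigsetU_measurable.
have UE : U `<=` E by rewrite /U -bigcup_seq => w [s' _ []].
have intU (g : S -> R) : (\int[P]_(w in U) (g (N t.+1 w))%:E =
    (fine (P E) * \sum_(s' <- nb) p s s' * g s')%:E)%E.
  rewrite integral_bigsetU_EFin//; last exact/measurable_EFinP.
  rewrite mulr_sumr -sumEFin; apply: eq_bigr => s' _.
  rewrite (eq_integral (fun=> (g s')%:E)); last by move=> w /set_mem[_ ->].
  have PEs : P (Es s') = (fine (P E) * p s s')%:E.
    by rewrite EFinM -PEfin; exact: markov_step.
  transitivity ((g s')%:E * P (Es s'))%E; first exact: integral_cst.
  by rewrite PEs -EFinM mulrC mulrA.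
have PU : P U = P E.
  have := intU (fun=> 1); rewrite integral_cst// mul1e => ->.
  by under eq_bigr do rewrite mulr1; rewrite p1 mulr1 -PEfin.
have mEU : measurable (E `\` U) by exact: measurableD.
have PEU : P (E `\` U) = 0%E.
  transitivity (P E - P (E `&` U))%E.
    by apply: measureD => //; rewrite ltey_eq fin_num_measure.
  by rewrite (setIidr UE) PU subee// PEfin.
rewrite /cond_expectation.
rewrite (eq_integral (fun w => (f (N t.+1 w))%:E)); last first.
  by move=> w /set_mem Ew; rewrite XE.
rewrite -{2}(setDUK UE) integral_setU//; last 2 first.
- exact/measurable_EFinP.
- by apply/disj_setPS => w [Uw []].
rewrite intU null_set_integral//; last exact/measurable_EFinP.
by rewrite adde0 -EFinM mulKf// gt_eqF.
Qed.

End markov_chain_step.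

Lemma uniformized_sum (R : realType) (J I : nat) (C : 'cV[R]_J)
    (mu nu : 'cV[R]_I) (Lambda : 'cV[R]_I -> 'cV[R]_I) (s : state I) :
  exists2 nb : seq (state I), uniq nb & forall g : state I -> R,
    \sum_(s' <- nb) uniformized C mu nu Lambda s s' * g s' =
    g s + (Xi C mu nu)^-1 *
      (\sum_i nu i 0 * (g (s + unit_state i) - g s) +
       \sum_(i | (0 < s i ord0)%N) mu i 0 * Lambda (real_state R s) i 0 *
          (g (removed s i) - g s)).
Proof.
pose nb0 := undup ([seq s + unit_state i | i : 'I_I] ++ [seq removed s i | i : 'I_I]).
pose nb := rem s nb0.
have unb0 : uniq nb0 by exact: undup_uniq.
have unb : uniq nb by exact: rem_uniq.
have snb : s \notin nb by rewrite mem_rem_uniqF.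
have unit_inj i : injective (fun x : state I => x + unit_state i).
  move=> x y /matrixP xy; apply/matrixP => k j; have := xy k j.
  by rewrite !mxE => /addIn.
have unit_gt0 (x : state I) (i : 'I_I) : (0 < (x + unit_state i)%R i ord0)%N.
  by rewrite !mxE !eqxx [X in (_ < X)%N](_ : _ = (x i ord0).+1)//; exact: addn1.
have unit_neq (x : state I) i : x + unit_state i != x.
  apply/eqP => /matrixP/(_ i ord0); rewrite !mxE !eqxx => /eqP.
  by rewrite -[eqbRHS]addn0 (inj_eq (@addnI _)).
have mem_nb x : x != s -> (x \in nb) =
    ((x \in [seq s + unit_state i | i : 'I_I]) ||
     (x \in [seq removed s i | i : 'I_I])).
  by move=> xs; rewrite mem_rem_uniq// inE xs mem_undup mem_cat.
exists (s :: nb); first by rewrite /= snb.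
move=> g; rewrite big_cons /uniformized eqxx.
set lam := Lambda (real_state R s); set X := Xi C mu nu.
have rateE (F : state I -> R) : \sum_(s' <- nb) rate mu nu Lambda s s' * F s' =
    \sum_i nu i 0 * F (s + unit_state i) +
    \sum_(i | (0 < s i ord0)%N) mu i 0 * lam i 0 * F (removed s i).
  under eq_bigr do rewrite /rate mulrDl !big_distrl/=.
  rewrite big_split/=; congr (_ + _).
    rewrite (exchange_big_dep xpredT)//=; apply: eq_bigr => i _.
    rewrite -big_filter (filter_pred1_uniq unb) ?big_seq1//.
    by rewrite mem_nb// fintype.image_f.
  rewrite (exchange_big_dep xpredT)//= [RHS]big_mkcond/=; apply: eq_bigr => i _.
  case: ifPn => si.
    rewrite (eq_bigl (pred1 (removed s i))); last first.
      move=> x /=; rewrite -{1}(removedK si) eq_sym.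
      exact: (inj_eq (unit_inj i)).
    rewrite -big_filter (filter_pred1_uniq unb) ?big_seq1//.
    rewrite mem_nb ?fintype.image_f ?orbT//.
    by have := unit_neq (removed s i) i; rewrite removedK// eq_sym.
  rewrite big_pred0// => x; apply/negbTE; apply: contra si => /eqP ->.
  exact: unit_gt0.
rewrite (eq_big_seq (fun s' => X^-1 * (rate mu nu Lambda s s' * g s'))).
  rewrite -mulr_sumr rateE /total_rate -/lam.
  under [X in _ = _ + _ * (X + _)]eq_bigr do rewrite mulrBr.
  under [X in _ = _ + _ * (_ + X)]eq_bigr do rewrite mulrBr.
  rewrite !sumrB -!mulr_suml; ring.
move=> s' s'nb; case: eqVneq => [e|_]; last by rewrite mulrAC mulrC.
by rewrite e (negbTE snb) in s'nb.
Qed.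

Lemma uniformized_drift (R : realType) (J I : nat) (C : 'cV[R]_J)
    (mu nu : 'cV[R]_I) (Lambda : 'cV[R]_I -> 'cV[R]_I)
    d (T : measurableType d) (P : probability T R) (N : nat -> T -> state I)
    (f : state I -> R) (t : nat) (s : state I) :
  markov_chain P (uniformized C mu nu Lambda) N ->
  (0 < P (N t @^-1` [set s]))%E ->
  cond_expectation P (fun w => f (N t.+1 w) - f (N t w)) (N t @^-1` [set s]) =
  ((Xi C mu nu)^-1 *
   (\sum_i nu i 0 * (f (s + unit_state i) - f s) +
    \sum_(i | (0 < s i ord0)%N) mu i 0 * Lambda (real_state R s) i 0 *
      (f (removed s i) - f s)))%:E.
Proof.
move=> chainN Ps; have [nb unb nbE] := uniformized_sum C mu nu Lambda s.
rewrite (cond_expectation_step (f := fun s' => f s' - f s) chainN Ps unb).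
- rewrite (nbE (fun s' => f s' - f s)) subrr add0r; congr ((_ * (_ + _))%:E).
    by apply: eq_bigr => i _; rewrite subr0.
  by apply: eq_bigr => i _; rewrite subr0.
- have := nbE (fun=> 1); under eq_bigr do rewrite mulr1.
  by move=> ->; rewrite !big1 ?addr0 ?mulr0 ?addr0// => i _; rewrite subrr mulr0.
- by move=> w ->.
Qed.

Lemma cvg_powRr (R : realType) (T : Type) (F : set_system T) (FF : Filter F)
    (f : T -> R) (p a : R) : 0 < a ->
  f x @[x --> F] --> a -> f x `^ p @[x --> F] --> a `^ p.
Proof.
move=> a0 fa; have : {for a, continuous (fun x => x `^ p)}.
  apply/differentiable_continuous/derivable1_diffP/derivable_powR.
  by rewrite in_itv/= a0.
by move=> /(cvg_comp _ _ fa).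
Qed.

Section load_dependent_constants.
Context {R : realType} {J I : nat}.
Variables (C : 'cV[R]_J) (kappa : 'cV[R]_I) (alpha : R).
Hypotheses (I_gt0 : (0 < I)%N).
Hypotheses (alpha_gt0 : 0 < alpha) (kappa_pos : positive kappa).

Local Notation pair_cV := ('cV[R]_I * 'cV[R]_I)%type.

Lemma load_dependentP (f : pair_cV -> R) :
  (forall z : pair_cV, positive z.1 -> positive z.2 ->
    f x @[x --> z] --> f z /\ 0 < f z) -> load_dependent f.
Proof.
move=> h; split; last by move=> z [z1 z2]; have [] := h z z1 z2.
apply: continuous_in_subspaceT => z /set_mem[z1 z2].
by have [] := h z z1 z2.
Qed.

Section at_point.
Variable z : pair_cV.
Hypotheses (z1_pos : positive z.1) (z2_pos : positive z.2).

Local Notation w x := (lyap_weight kappa alpha x.1 x.2).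

Let w_gt0 i : 0 < w z i. Proof. exact: lyap_weight_gt0. Qed.

Lemma cvg_fst_coord i : (x : pair_cV).1 i 0 @[x --> z] --> z.1 i 0.
Proof.
apply: (@cvg_comp _ _ _ fst (fun M : 'cV[R]_I => M i 0) _ (nbhs z.1)).
  exact: cvg_fst.
exact: coord_continuous.
Qed.

Lemma cvg_snd_coord i : (x : pair_cV).2 i 0 @[x --> z] --> z.2 i 0.
Proof.
apply: (@cvg_comp _ _ _ snd (fun M : 'cV[R]_I => M i 0) _ (nbhs z.2)).
  exact: cvg_snd.
exact: coord_continuous.
Qed.

Lemma cvg_sum_ord (f : 'I_I -> pair_cV -> R) :
  (forall i, f i x @[x --> z] --> f i z) ->
  \sum_i f i x @[x --> z] --> \sum_i f i z.
Proof. by move=> fz; apply: cvg_big => //; exact: add_continuous. Qed.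

Lemma cvg_lyap_weight i : w x i @[x --> z] --> w z i.
Proof.
apply: cvgM; last by apply: cvg_powRr => //; exact: cvg_snd_coord.
apply: cvgM; first exact: cvg_cst.
by apply: cvg_powRr => //; exact: cvg_fst_coord.
Qed.

Lemma cvg_lyap_slope :
  lyap_slope kappa alpha x.1 x.2 @[x --> z] --> lyap_slope kappa alpha z.1 z.2.
Proof.
have a1 : 0 < alpha + 1 by rewrite addr_gt0.
apply: cvgM.
  apply: cvg_powRr; first by rewrite mulr_gt0// (sum_ord_gt0 I_gt0).
  apply: cvgM; first exact: cvg_cst.
  by apply: cvg_sum_ord => i; exact: cvg_lyap_weight.
apply: cvg_sum_ord => i; apply: cvgV; first by rewrite gt_eqF// mulr_gt0.
by apply: cvgM; [exact: cvg_lyap_weight|exact: cvg_snd_coord].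
Qed.

Lemma cvg_Xi : Xi C x.1 x.2 @[x --> z] --> Xi C z.1 z.2.
Proof.
apply: cvg_sum_ord => i; apply: cvgD; first exact: cvg_snd_coord.
by apply: cvgM; [exact: cvg_fst_coord|exact: cvg_cst].
Qed.

Lemma cvg_lyap_noise :
  lyap_noise C kappa alpha x.1 x.2 @[x --> z] --> lyap_noise C kappa alpha z.1 z.2.
Proof.
apply: cvgM.
  apply: cvgM; first exact: cvg_cst.
  apply: cvg_sum_ord => i; apply: cvgM; first exact: cvg_lyap_weight.
  apply: cvgD; first exact: cvg_snd_coord.
  by apply: cvgM; [exact: cvg_fst_coord|exact: cvg_cst].
apply: cvg_powRr.
  by rewrite !mulr_gt0// (sum_ord_gt0 I_gt0)// => i; rewrite powR_gt0.
apply: cvgM; first exact: cvg_cst.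
apply: cvgM; first exact: cvg_cst.
by apply: cvg_sum_ord => i; apply: cvg_powRr => //; exact: cvg_lyap_weight.
Qed.

Lemma cvg_lyap_threshold :
  lyap_threshold C kappa alpha x.1 x.2 @[x --> z] -->
  lyap_threshold C kappa alpha z.1 z.2.
Proof.
have S0 := lyap_slope_gt0 I_gt0 alpha_gt0 kappa_pos z1_pos z2_pos.
have N0 := lyap_noise_gt0 C alpha I_gt0 kappa_pos z1_pos z2_pos.
have cvgSN : 2 * lyap_slope kappa alpha x.1 x.2 *
    lyap_noise C kappa alpha x.1 x.2 @[x --> z] -->
    2 * lyap_slope kappa alpha z.1 z.2 * lyap_noise C kappa alpha z.1 z.2.
  apply: cvgM; last exact: cvg_lyap_noise.
  by apply: cvgM; [exact: cvg_cst|exact: cvg_lyap_slope].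
rewrite /lyap_threshold; case: (1 <= alpha); first exact: cvgSN.
by apply: cvg_powRr cvgSN; rewrite (mulr_gt0 (mulr_gt0 _ S0) N0).
Qed.

End at_point.

Lemma load_dependent_threshold :
  load_dependent (fun z => lyap_threshold C kappa alpha z.1 z.2).
Proof.
apply: load_dependentP => z z1 z2; split; first exact: cvg_lyap_threshold.
exact: lyap_threshold_gt0.
Qed.

Lemma load_dependent_drift :
  load_dependent (fun z => (2 * lyap_slope kappa alpha z.1 z.2 * Xi C z.1 z.2)^-1).
Proof.
apply: load_dependentP => z z1 z2.
have S0 := lyap_slope_gt0 I_gt0 alpha_gt0 kappa_pos z1 z2.
have X0 := Xi_gt0 C I_gt0 z1 z2.
have SX0 : 0 < 2 * lyap_slope kappa alpha z.1 z.2 * Xi C z.1 z.2.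
  by rewrite (mulr_gt0 (mulr_gt0 _ S0) X0).
split; last by rewrite invr_gt0.
apply: cvgV; first by rewrite gt_eqF.
apply: cvgM; last exact: cvg_Xi.
by apply: cvgM; [exact: cvg_cst|exact: cvg_lyap_slope].
Qed.

End load_dependent_constants.

Theorem theorem5p3 (R : realType) (J I : nat) (route : 'I_I -> {set 'I_J})
    (C : 'cV[R]_J) (kappa : 'cV[R]_I) (alpha : R)
    (J_gt0 : (0 < J)%N)
    (route_neq0 : forall i, route i != finset.set0)
    (route_inj : injective route)
    (rankA : \rank (incidence R route) = J)
    (C_pos : positive C) (kappa_pos : positive kappa) (alpha_gt0 : 0 < alpha) :
  exists K K' : 'cV[R]_I * 'cV[R]_I -> R,
    load_dependent K /\ load_dependent K' /\
    forall (Lambda : 'cV[R]_I -> 'cV[R]_I) (mu nu : 'cV[R]_I),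
      alpha_fair (incidence R route) C kappa alpha Lambda ->
      positive mu -> positive nu ->
      (forall j, (incidence R route *m load mu nu) j 0 < C j 0) ->
      let eps := gap (incidence R route) C (load mu nu) in
      let L := fun s : state I => lyapunov kappa alpha mu nu (real_state R s) in
      exists B : R,
        0 < B /\
        B = (if 1 <= alpha then K' (mu, nu) / eps
             else K' (mu, nu) / Num.min (eps `^ (1 / alpha)) eps) /\
        forall (d : measure_display) (T : measurableType d)
          (P : probability T R) (N : nat -> T -> state I),
          markov_chain P (uniformized C mu nu Lambda) N ->
          forall (tau : nat) (s : state I),
            (0 < P (N tau @^-1` [set s]))%E -> B < L s ->
            (cond_expectation P (fun w => (L (N tau.+1 w) - L (N tau w))%R)
               (N tau @^-1` [set s]) <= (- (eps * K (mu, nu)))%:E)%E.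
Proof.
have I_gt0 : (0 < I)%N.
  by rewrite (leq_trans J_gt0)// -[X in (X <= _)%N]rankA rank_leq_col.
exists (fun z => (2 * lyap_slope kappa alpha z.1 z.2 * Xi C z.1 z.2)^-1).
exists (fun z => lyap_threshold C kappa alpha z.1 z.2).
split; first exact: load_dependent_drift.
split; first exact: load_dependent_threshold.
move=> Lambda mu nu fair mu_pos nu_pos stable eps L /=.
have [eps0 _] := gap_load I_gt0 route_neq0 mu_pos nu_pos stable.
have T0 := lyap_threshold_gt0 C I_gt0 alpha_gt0 kappa_pos mu_pos nu_pos.
exists (if 1 <= alpha then lyap_threshold C kappa alpha mu nu / eps
   else lyap_threshold C kappa alpha mu nu / Num.min (eps `^ (1 / alpha)) eps).
split.
  case: ifP => _; first by rewrite divr_gt0.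
  by rewrite divr_gt0// lt_min powR_gt0.
split=> // d T P N chainN tau s Ps Ls.
rewrite (uniformized_drift L chainN Ps) lee_fin.
have X0 := Xi_gt0 C I_gt0 mu_pos nu_pos.
apply: (@le_trans _ _ ((Xi C mu nu)^-1 *
    - (eps / (2 * lyap_slope kappa alpha mu nu)))).
  rewrite ler_pM2l ?invr_gt0//.
  exact: (lyapunov_drift I_gt0 route_neq0 alpha_gt0 kappa_pos mu_pos nu_pos
    fair stable Ls).
by rewrite mulrN mulrCA -invfM [Xi C mu nu * _]mulrC.
Qed.
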